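(* Fix any strictly increasing $\vartheta\in C_0(\mathbb{R}_+,\mathbb{R})$ with $\lim_{t\to\infty}\vartheta(t)=\infty$. Let $\Phi_\vartheta\subset\Phi$ contain the paths $\varphi\in\Phi$ which verify $\sup_{t\in\mathbb{R}_+}\vartheta(t)-\varphi'(t)=\infty$, and let $\mathrm{G}_\vartheta\subset\mathrm{G}$ contain the functions $g$ with representation $g(t,x)=\vartheta(t)-w(x)$ for some $w\in C(\mathbb{R}_+,\mathbb{R})$ with $w(0)\le0$ and $\sup_{x\in\mathbb{R}_+}w(x)=\infty$. Then the map which takes each $g\in\mathrm{G}_\vartheta$ to the (unique) global solution $\varphi\in\Phi_\vartheta$ of the initial value problem $x'=g(t,x)$, $x(0)=0$ is bijective from $\mathrm{G}_\vartheta$ to $\Phi_\vartheta$.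
   Context: $\mathbb{R}_+=[0,\infty)$. $C_0(\mathbb{R}_+,\mathbb{R})$ is the set of continuous paths starting from $0$ at time $0$. $\Phi$ is the set of bijective paths in $C^1_0(\mathbb{R}_+,\mathbb{R}_+)$, i.e. continuously differentiable bijections of $\mathbb{R}_+$ onto itself starting from $0$. $\mathrm{G}\subset C(\mathbb{R}_+^2,\mathbb{R})$ is the set of continuous $g:\mathbb{R}_+^2\to\mathbb{R}$, $(t,x)\mapsto g(t,x)$, such that: (i) $g(0,0)\ge0$; (ii) $g(\cdot,x)$ is strictly increasing for each $x\in\mathbb{R}_+$; (iii) $\inf_{x\in\mathbb{R}_+}g(t,x)<0$ for all $t\in\mathbb{R}_+$; (iv) $\sup_{t\in\mathbb{R}_+}g(t,x)>0$ for all $x\in\mathbb{R}_+$. A global solution of $x'=g(t,x)$, $x(0)=0$ is $\varphi\in C^1_0(\mathbb{R}_+,\mathbb{R}_+)$ verifying $\varphi'(t)=g(t,\varphi(t))$ for all $t\in\mathbb{R}_+$ and $\varphi(0)=0$; for $g\in\mathrm{G}$ it exists, is unique, and belongs to $\Phi$. *)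

(* Defs.v *)
From HB Require Import structures.
From mathcomp Require Import all_boot all_order all_algebra.
From mathcomp Require Import all_classical all_reals all_analysis.

Set Implicit Arguments.
Unset Strict Implicit.
Unset Printing Implicit Defensive.

Import Order.TTheory GRing.Theory Num.Theory.
Import numFieldNormedType.Exports.

Local Open Scope classical_set_scope.
Local Open Scope ring_scope.

(* The half-line is the subtype [0, +oo[ of R with the topology induced by R,
   so that two functions on it are equal as soon as they agree on [0, +oo[. *)
Notation Rplus R := (set_type [set` `[(0 : R), +oo[]).

Section Paths.
Variable R : realType.
Implicit Types (theta w : Rplus R -> R) (phi : Rplus R -> Rplus R).
Implicit Types (g : Rplus R * Rplus R -> R).

Lemma zero_in_Rplus : (0 : R) \in [set` `[(0 : R), +oo[].
Proof. by rewrite inE /= in_itv /= lexx. Qed.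

Definition zero_Rplus : Rplus R := exist _ 0 zero_in_Rplus.

Definition infty_Rplus : set_system (Rplus R) :=
  filter_from setT (fun A : R => [set t | A <= \val t]).

Definition strictly_increasing (f : Rplus R -> R) : Prop :=
  forall s t, \val s < \val t -> f s < f t.

Definition C0_path theta : Prop := continuous theta /\ theta zero_Rplus = 0.

(* The punctured neighbourhoods t^' are those of the half-line: these are the
   usual two-sided quotients for t > 0 and the right-hand ones at t = 0. *)
Definition diff_quotient phi (t s : Rplus R) : R :=
  (\val (phi s) - \val (phi t)) / (\val s - \val t).

Definition path_derive phi (t : Rplus R) : R :=
  lim (diff_quotient phi t s @[s --> t^']).

Definition C10_path phi : Prop :=
  [/\ phi zero_Rplus = zero_Rplus,
      forall t, cvg (diff_quotient phi t s @[s --> t^'])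
    & continuous (path_derive phi)].

Definition PhiSet : set (Rplus R -> Rplus R) :=
  [set phi : Rplus R -> Rplus R | C10_path phi /\ bijective phi].

Definition GSet : set (Rplus R * Rplus R -> R) :=
  [set g : Rplus R * Rplus R -> R | [/\ continuous g,
               0 <= g (zero_Rplus, zero_Rplus),
               forall x, strictly_increasing (fun t => g (t, x)),
               forall t, (ereal_inf (range (fun x => (g (t, x))%:E)) < 0)%E
             & forall x, (0 < ereal_sup (range (fun t => (g (t, x))%:E)))%E]].

Definition global_solution g phi : Prop :=
  C10_path phi /\ forall t, path_derive phi t = g (t, phi t).

(* The default value id is irrelevant when a global solution exists. *)
Definition solution g : Rplus R -> Rplus R :=
  xget (@id (Rplus R)) [set phi | global_solution g phi].

Definition PhiTheta theta : set (Rplus R -> Rplus R) :=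
  [set phi | PhiSet phi /\
    ereal_sup (range (fun t => (theta t - path_derive phi t)%:E)) = +oo%E].

Definition GTheta theta : set (Rplus R * Rplus R -> R) :=
  [set g : Rplus R * Rplus R -> R | GSet g /\
    exists w, [/\ continuous w,
                  w zero_Rplus <= 0,
                  ereal_sup (range (fun x => (w x)%:E)) = +oo%E
                & forall t x, g (t, x) = theta t - w x]].

End Paths.

(* Main.v *)
Require Import Defs.
From mathcomp Require Import all_boot all_order all_algebra.
From mathcomp Require Import all_classical all_reals all_analysis.
From mathcomp Require Import lra.

Set Implicit Arguments.
Unset Strict Implicit.
Unset Printing Implicit Defensive.

Import Order.TTheory GRing.Theory Num.Theory.
Import numFieldNormedType.Exports.

Local Open Scope classical_set_scope.
Local Open Scope ring_scope.

(* A time-shifted solution t |-> phi (t + c), c > 0, has a strictly larger slope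
   than phi whenever the two are at the same height, because g is strictly
   increasing in t. Hence it can never be overtaken by any other solution; letting
   c -> 0 gives uniqueness without a Lipschitz condition, and comparing a solution
   with its own shifts shows that it increases. It is unbounded because theta is,
   so it is a bijection of the half-line. Existence: a level X with
   w X > theta T is a barrier up to time T, so w may be truncated, and Euler
   step functions converge along an ultrafilter; uniqueness glues the pieces.
   The inverse map sends phi to w = (theta - phi') o phi^-1. *)

(** * Barriers and one-sided derivatives on the half-line *)

Section HalfLine.
Variable R : realType.
Implicit Types (D F : R -> R) (s t u v c e : R).

(* [F] has derivative [l] at [t] relative to the half-line: two-sided for
   [t > 0], right-hand at [t = 0]. *)
Definition hderiv F t l := forall e, 0 < e -> exists2 d, 0 < d &
  forall s, 0 <= s -> `|s - t| < d -> `|F s - F t - l * (s - t)| <= e * `|s - t|.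

(** Consider the supremum of the points of [[a, u1]] where [D] is nonnegative. Since negativity is
    an open condition, [D] is nonnegative there too; if this point lay before [u1], nonnegativity
    would persist to its right. *)
Lemma barrier D a b : 0 <= D a ->
  (forall u, a <= u <= b -> D u < 0 -> exists2 d, 0 < d &
     forall v, a <= v -> `|v - u| < d -> D v < 0) ->
  (forall u, a <= u < b -> 0 <= D u -> exists2 d, 0 < d &
     forall v, u < v < u + d -> 0 <= D v) ->
  forall u, a <= u <= b -> 0 <= D u.
Proof.
move=> Da Dneg Dpos u1 /andP[au1 u1b].
rewrite leNgt; apply/negP => Du1.
pose A := [set u | a <= u <= u1 /\ 0 <= D u].
have Aa : A a by split=> //; rewrite lexx.
have ubA : ubound A u1 by move=> u [] /andP[].
have hA : has_sup A by split; [exists a | exists u1].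
have as' : a <= sup A by apply: ub_le_sup => //; exists u1.
have su1 : sup A <= u1 by apply: ge_sup => //; exists a.
set s := sup A in as' su1.
have Ds : 0 <= D s.
  rewrite leNgt; apply/negP => Ds.
  have sb : a <= s <= b by apply/andP; split=> //; lra.
  have [d d0 /= dD] := Dneg s sb Ds.
  have [v [/andP[av vu1] Dv] sv] := sup_adherent d0 hA.
  rewrite -/s in sv; have vs : v <= s.
    by apply: ub_le_sup; [exists u1 | split=> //; apply/andP].
  have Dv0 : D v < 0 by apply: dD => //; rewrite ltr_norml; apply/andP; split; lra.
  by rewrite leNgt Dv0 in Dv.
have lsu : s < u1.
  by rewrite lt_neqAle su1 andbT; apply/eqP => E; move: Ds; rewrite E leNgt Du1.
have [|d d0 dD] := Dpos s _ Ds; first by apply/andP; split=> //; lra.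
pose v := s + Num.min (d / 2) (u1 - s).
have m0 : 0 < Num.min (d / 2) (u1 - s) by rewrite lt_min; apply/andP; split; lra.
have m1 : Num.min (d / 2) (u1 - s) <= d / 2 by rewrite ge_min lexx.
have m2 : Num.min (d / 2) (u1 - s) <= u1 - s by rewrite ge_min lexx orbT.
have vs : v <= s.
  apply: ub_le_sup; first by exists u1.
  split; first by rewrite /v; apply/andP; split; lra.
  by apply: dD; rewrite /v; apply/andP; split; lra.
by move: vs; rewrite /v; lra.
Qed.

Lemma hderiv_continuous F t l : hderiv F t l ->
  forall e, 0 < e -> exists2 d, 0 < d &
    forall s, 0 <= s -> `|s - t| < d -> `|F s - F t| < e.
Proof.
move=> hF e e0; have [d d0 dF] := hF 1 ltr01.
have L0 : 0 < `|l| + 1 by rewrite ltr_wpDl.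
(* With tolerance 1 on the slope, the increment is at most [(|l| + 1) * |s - t|]. *)
exists (Num.min d (e / (`|l| + 1))) => [|s s0].
  by rewrite lt_min d0 divr_gt0.
rewrite lt_min => /andP[sd se]; have := dF s s0 sd.
move: se; rewrite ltr_pdivlMr // => se h.
have -> : F s - F t = (F s - F t - l * (s - t)) + l * (s - t) by rewrite subrK.
apply: le_lt_trans (ler_normD _ _) _; rewrite normrM.
by lra.
Qed.

Lemma hderiv_near F G t l d : 0 < d -> 0 <= t ->
  (forall s, 0 <= s -> `|s - t| < d -> F s = G s) -> hderiv F t l -> hderiv G t l.
Proof.
move=> d0 t0 FG hF e e0; have [d' d'0 h] := hF e e0.
exists (Num.min d d') => [|s s0]; first by rewrite lt_min d0.
rewrite lt_min => /andP[sd sd']; rewrite -(FG s s0 sd) -(FG t t0) ?subrr ?normr0 //.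
exact: h.
Qed.

Lemma hderivD F G t l l' : hderiv F t l -> hderiv G t l' ->
  hderiv (fun s => F s + G s) t (l + l').
Proof.
move=> hF hG e e0; have e20 : 0 < e / 2 by lra.
have [d d0 h] := hF _ e20; have [d' d'0 h'] := hG _ e20.
exists (Num.min d d') => [|s s0]; first by rewrite lt_min d0.
rewrite lt_min => /andP[/(h s s0) h1 /(h' s s0) h2].
rewrite (_ : _ - _ - _ = (F s - F t - l * (s - t)) + (G s - G t - l' * (s - t))).
  by apply: le_trans (ler_normD _ _) _; lra.
lra.
Qed.

Lemma hderivN F t l : hderiv F t l -> hderiv (fun s => - F s) t (- l).
Proof.
move=> hF e e0; have [d d0 h] := hF _ e0; exists d => // s s0 sd.
have -> : - F s - - F t - - l * (s - t) = - (F s - F t - l * (s - t)) by lra.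
by rewrite normrN h.
Qed.

Lemma hderiv_affine a b t : hderiv (fun s => a * s + b) t a.
Proof.
move=> e e0; exists 1 => // s _ _.
rewrite (_ : _ - _ = 0); last lra.
by rewrite normr0 mulr_ge0 // ltW.
Qed.

Lemma hderiv_shift F c t l : 0 <= c -> 0 <= t ->
  hderiv F (t + c) l -> hderiv (fun s => F (s + c)) t l.
Proof.
move=> c0 t0 hF e e0; have [d d0 h] := hF _ e0; exists d => // s s0 sd.
have E : s + c - (t + c) = s - t by lra.
by have := h (s + c); rewrite E; apply=> //; rewrite addr_ge0.
Qed.

(** By continuity [D] can become negative only through a zero, and there the positive slope pushes
    it back up. *)
Lemma hderiv_barrier D (D' : R -> R) a b : 0 <= a -> 0 <= D a ->
  (forall u, a <= u <= b -> hderiv D u (D' u)) ->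
  (forall u, a <= u < b -> D u = 0 -> 0 < D' u) ->
  forall u, a <= u <= b -> 0 <= D u.
Proof.
move=> a0 Da hD zD; apply: barrier => // u.
  move=> aub Du; have [d d0 h] := hderiv_continuous (hD u aub) (e := - D u) ltac:(lra).
  exists d => // v av /h => /(_ ltac:(lra)); rewrite ltr_norml; lra.
move=> /andP[au ub] Du.
have hu := hD u ltac:(apply/andP; split; lra).
have [Dz|Dz] := eqVneq (D u) 0.
  have D'u : 0 < D' u by apply: zD => //; apply/andP.
  (* Taking the slope itself as tolerance keeps [D v] between 0 and [2 * D' u * (v - u)]. *)
  have [d d0 h] := hu _ D'u; exists d => // v /andP[uv vd].
  have vu0 : 0 <= v - u by lra.
  have := h v ltac:(lra); rewrite ger0_norm // => /(_ ltac:(lra)).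
  by rewrite Dz ler_norml; lra.
have Dp : 0 < D u by rewrite lt_neqAle eq_sym Dz.
have [d d0 h] := hderiv_continuous hu Dp.
exists d => // v /andP[uv vd].
have vu0 : 0 <= v - u by lra.
have := h v ltac:(lra); rewrite ger0_norm // => /(_ ltac:(lra)).
by rewrite ltr_norml; lra.
Qed.

End HalfLine.

(** * Comparison of solutions *)

Section Solutions.
Variable R : realType.
Implicit Types (th w F : R -> R) (s t u c x B K T : R).

Definition increasing_pos th := forall s t, 0 <= s -> s < t -> th s < th t.

(** For [T > 0] only the values of [F] on [[0, T)] matter, so solutions with different horizons can
    be compared and glued as total functions. *)
Definition solves th w T F := F 0 = 0 /\
  forall t, 0 <= t < T -> 0 <= F t /\ hderiv F t (th t - w (F t)).

Lemma solvesW th w T T' F : T <= T' -> solves th w T' F -> solves th w T F.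
Proof.
move=> TT' [F0 hF]; split=> // t /andP[t0 tT]; apply: hF; apply/andP; split=> //; lra.
Qed.

Lemma solves_shift_le th w T F1 F2 c u : increasing_pos th ->
  solves th w T F1 -> solves th w T F2 -> 0 < c -> 0 <= u -> u + c < T ->
  F1 u <= F2 (u + c).
Proof.
move=> incr [F10 h1] [F20 h2] c0 u0 ucT.
rewrite -subr_ge0.
apply: (@hderiv_barrier _ (fun v => F2 (v + c) - F1 v)
  (fun v => (th (v + c) - w (F2 (v + c))) - (th v - w (F1 v))) 0 u) => //.
- by rewrite F10 subr0 add0r; have [] := h2 c ltac:(lra).
- move=> v /andP[v0 vu].
  have [_ d1] := h1 v ltac:(lra); have [_ d2] := h2 (v + c) ltac:(lra).
  by apply: hderivD; [apply: hderiv_shift => //; lra | exact: hderivN].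
(* At a zero of the difference the heights agree, the [w] terms cancel, and the slope is
   [th (v + c) - th v > 0]. *)
- move=> v /andP[v0 vu] Dv.
  have -> : F2 (v + c) = F1 v by lra.
  by have := incr v (v + c) v0 ltac:(lra); lra.
- by rewrite u0 lexx.
Qed.

Lemma solves_le th w T F1 F2 u : increasing_pos th ->
  solves th w T F1 -> solves th w T F2 -> 0 <= u < T -> F1 u <= F2 u.
Proof.
move=> incr s1 s2 /andP[u0 uT]; rewrite leNgt; apply/negP => lt21.
have [_ hd] := s2.2 u ltac:(lra).
have [d d0 h] := hderiv_continuous hd (e := F1 u - F2 u) ltac:(lra).
(* Halving makes both [c < d] and [u + c < T] strict. Then [F2 (u + c)] is still below [F1 u],
   against the shift comparison. *)
pose c := Num.min d (T - u) / 2.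
have m1 : Num.min d (T - u) <= d by rewrite ge_min lexx.
have m2 : Num.min d (T - u) <= T - u by rewrite ge_min lexx orbT.
have m3 : 0 < Num.min d (T - u) by rewrite lt_min d0; lra.
have c0 : 0 < c by rewrite /c; lra.
have ucT : u + c < T by rewrite /c; move: m2; set mm := Num.min _ _; lra.
have := solves_shift_le incr s1 s2 c0 u0 ucT.
have := h (u + c) ltac:(lra).
have -> : u + c - u = c by lra.
rewrite gtr0_norm // => /(_ ltac:(rewrite /c; lra)).
by rewrite ltr_norml; lra.
Qed.

Lemma solves_unique th w T1 T2 F1 F2 u : increasing_pos th ->
  solves th w T1 F1 -> solves th w T2 F2 -> 0 <= u -> u < T1 -> u < T2 ->
  F1 u = F2 u.
Proof.
move=> incr s1 s2 u0 u1 u2; pose T := Num.min T1 T2.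
have uT : 0 <= u < T by rewrite u0 lt_min u1.
have {}s1 : solves th w T F1 by apply: solvesW s1; rewrite ge_min lexx.
have {}s2 : solves th w T F2 by apply: solvesW s2; rewrite ge_min lexx orbT.
by apply/eqP; rewrite eq_le !(@solves_le th w T).
Qed.

Lemma solves_nondecreasing th w T F s t : increasing_pos th ->
  solves th w T F -> 0 <= s -> s <= t -> t < T -> F s <= F t.
Proof.
move=> incr sF s0; rewrite le_eqVlt => /orP[/eqP-> //|st] tT.
have -> : t = s + (t - s) by lra.
have sF' := sF.
by apply: (solves_shift_le incr sF sF') => //; lra.
Qed.

(* On an interval where F is constant its slope vanishes, which th forbids. *)
Lemma solves_increasing th w T F s t : increasing_pos th ->
  solves th w T F -> 0 <= s -> s < t -> t < T -> F s < F t.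
Proof.
move=> incr sF s0 st tT; rewrite lt_neqAle (solves_nondecreasing incr sF) ?andbT ?(ltW st) //.
apply/eqP => E.
have flat u : s <= u < t -> th u = w (F s) .
  move=> /andP[su ut].
  have Fu v : s <= v <= t -> F v = F s.
    move=> /andP[sv vt]; apply/eqP; rewrite eq_le {1}E.
    by rewrite !(solves_nondecreasing incr sF) //; lra.
  have [_ hd] := sF.2 u ltac:(lra).
  (* The quotient of [F] over [[u, u + m]] is zero, so the slope at [u] is at most every [e > 0] in
     absolute value. *)
  suff : `|th u - w (F u)| <= 0.
    by rewrite normr_le0 subr_eq0 => /eqP ->; rewrite Fu //; lra.
  apply/ler_addgt0Pl => e e0; rewrite addr0; have [d d0 h] := hd e e0.
  pose m := Num.min d (t - u) / 2.
  have m1 : Num.min d (t - u) <= d by rewrite ge_min lexx.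
  have m2 : Num.min d (t - u) <= t - u by rewrite ge_min lexx orbT.
  have m3 : 0 < Num.min d (t - u) by rewrite lt_min d0; lra.
  have m0 : 0 < m by rewrite /m; lra.
  have := h (u + m) ltac:(lra).
  have -> : u + m - u = m by lra.
  rewrite gtr0_norm // => /(_ ltac:(rewrite /m; lra)).
  rewrite !Fu; [|lra|rewrite /m; lra].
  by rewrite subrr sub0r normrN normrM (gtr0_norm m0) ler_pM2r.
(* Flatness gives [th] the same value at [s] and at the midpoint. *)
have := incr s ((s + t) / 2) s0 ltac:(lra).
by rewrite !flat; lra.
Qed.

Definition gsolves th w F := forall T, solves th w T F.

Lemma gsolvesP th w F : gsolves th w F <->
  F 0 = 0 /\ forall t, 0 <= t -> 0 <= F t /\ hderiv F t (th t - w (F t)).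
Proof.
split=> [sF|[F0 hF] T]; last by split=> // t /andP[t0 _]; exact: hF.
split; first by have [] := sF 0.
by move=> t t0; apply: (sF (t + 1)).2; lra.
Qed.

Lemma gsolves_unbounded th w F :
  (forall B, exists K, forall x, 0 <= x <= B -> w x <= K) ->
  (forall K, exists2 t0, 0 <= t0 & forall t, t0 <= t -> K <= th t) ->
  gsolves th w F -> forall B, exists2 t, 0 <= t & B < F t.
Proof.
move=> wb thb /gsolvesP[F0 hF] B.
apply: contrapT => nB.
have FB t : 0 <= t -> F t <= B.
  by move=> t0; rewrite leNgt; apply/negP => FtB; apply: nB; exists t.
(* If [F] stays below [B], then [w (F t) <= K], so from [t0] on the slope is at least 2 and [F]
   stays above the line of slope 1 through its value at [t0]. At time [t0 + B + 1] that line exceeds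
   [B]. *)
have [K wK] := wb B; have [t0 t00 tht] := thb (K + 2).
have B0 : 0 <= B by rewrite -F0; apply: FB.
suff : 0 <= F (t0 + B + 1) - (F t0 + ((t0 + B + 1) - t0)).
  by have := FB (t0 + B + 1) ltac:(lra); have := (hF t0 t00).1; lra.
apply: (@hderiv_barrier _ (fun v => F v - (F t0 + (v - t0)))
  (fun v => (th v - w (F v)) - 1) t0 (t0 + B + 1)) => //.
- by lra.
- move=> v /andP[v0 vu]; have [_ d1] := hF v ltac:(lra).
  apply: hderivD => //; apply: hderivN.
  rewrite (_ : (fun _ => _) = (fun v => 1 * v + (F t0 - t0))); first exact: hderiv_affine.
  by apply/funext => z; lra.
- move=> v /andP[v0 vu] _; have v00 : 0 <= v by lra.
  by have := tht v v0; have := wK (F v); rewrite FB // (hF v v00).1 => /(_ isT); lra.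
- by lra.
Qed.

(** Extending by the constant [F 0] on the left turns one-sided continuity at 0 into continuity on
    the line, for use with the intermediate value theorem. *)
Lemma pos_continuous F (l : R -> R) : (forall t, 0 <= t -> hderiv F t (l t)) ->
  continuous (fun x : R => F (Num.max x 0)).
Proof.
move=> hF x; apply/cvgrPdist_lt => e e0.
have m0 : 0 <= Num.max x 0 by rewrite le_max lexx orbT.
have [d d0 h] := hderiv_continuous (hF _ m0) e0.
apply/nbhs_ballP; exists d => // y xy; have {}xy : `|x - y| < d := xy.
rewrite distrC; apply: h; first by rewrite le_max lexx orbT.
apply: le_lt_trans xy; have := ler_norm (y - x); have := ler_norm (x - y).
by rewrite (distrC y) ler_norml; case: (leP x 0) => ?; case: (leP y 0) => ?; lra.
Qed.

Lemma gsolves_surjective th w F :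
  (forall B, exists K, forall x, 0 <= x <= B -> w x <= K) ->
  (forall K, exists2 t0, 0 <= t0 & forall t, t0 <= t -> K <= th t) ->
  gsolves th w F -> forall x, 0 <= x -> exists2 t, 0 <= t & F t = x.
Proof.
move=> wb thb sF x x0; have [b b0 Fb] := gsolves_unbounded wb thb sF x.
have [F0 hF] := (gsolvesP _ _ _).1 sF.
have cF := pos_continuous (fun t ht => (hF t ht).2).
have [||c] := @IVT R (fun x => F (Num.max x 0)) 0 b x b0.
- exact: continuous_subspaceT.
- by rewrite maxxx F0 (max_l b0) ge_min x0 le_max (ltW Fb) orbT.
- rewrite in_itv /= => /andP[c0 _]; rewrite (max_l c0) => Fc; by exists c.
Qed.

End Solutions.

(** * Euler approximations *)

Section Euler.
Variable R : realType.
Variables (f : R -> R -> R) (K : R).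
Implicit Types (h s t r l e : R).

Fixpoint euler h k : R :=
  if k is k'.+1 then euler h k' + h * f (h * k'%:R) (euler h k') else 0.

(** Each of the [m] steps contributes an error of at most [e * h], and these add up. *)
Lemma euler_slope h l e i m : 0 <= h ->
  (forall k, (i <= k < i + m)%N -> `|f (h * k%:R) (euler h k) - l| <= e) ->
  `|euler h (i + m) - euler h i - l * (h * m%:R)| <= e * (h * m%:R).
Proof.
move=> h0; elim: m => [|m IH] fl.
  by rewrite addn0 !mulr0 subrr subr0 normr0.
have {IH}/IH IH k : (i <= k < i + m)%N -> `|f (h * k%:R) (euler h k) - l| <= e.
  by move=> /andP[ik km]; apply: fl; rewrite ik addnS ltnS ltnW.
have := fl (i + m)%N; rewrite addnS leq_addr ltnS leqnn => /(_ isT) flm.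
rewrite /= -natr1.
have := ler_wpM2l h0 flm; rewrite -[X in X * `|_|](ger0_norm h0) -normrM => hflm.
set a := euler h (i + m) in IH hflm *; set b := f _ _ in hflm *.
have -> : a + h * b - euler h i - l * (h * (m%:R + 1)) =
  (a - euler h i - l * (h * m%:R)) + h * (b - l) by lra.
apply: le_trans (ler_normD _ _) _. lra.
Qed.

(** Piecewise constant interpolation instead of Euler polygons: the jumps are of the order of the
    mesh and vanish in the limit. *)
Definition estep h t := euler h (Num.trunc (t / h)).

Lemma estep_grid h k : 0 < h -> estep h (h * k%:R) = euler h k.
Proof. by move=> h0; rewrite /estep mulrAC divff ?mul1r ?natrK // gt_eqF. Qed.

Lemma estep0 h : estep h 0 = 0.
Proof. by rewrite /estep mul0r truncn0. Qed.

(** Rounding [s] and [t] down to the grid changes the elapsed time by at most [h], which costs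
    [(e + |l|) * h]. The window starts at [s - h] because the grid point below [s] is used. *)
Lemma estep_slope_le h s t l e : 0 < h -> 0 <= s -> s <= t ->
  (forall r, 0 <= r -> s - h < r <= t -> `|f r (estep h r) - l| <= e) ->
  `|estep h t - estep h s - l * (t - s)| <= e * (t - s) + (e + `|l|) * h.
Proof.
move=> h0 s0 st fl.
have e0 : 0 <= e.
  by apply: le_trans (normr_ge0 _) (fl s s0 _); apply/andP; split; lra.
have t0 : 0 <= t by lra.
have sh0 : 0 <= s / h by rewrite divr_ge0 // ltW.
have th0 : 0 <= t / h by rewrite divr_ge0 // ltW.
have lij : (Num.trunc (s / h) <= Num.trunc (t / h))%N.
  by apply: le_truncn; rewrite ler_pM2r // invr_gt0.
have /andP[] := truncn_itv sh0; have /andP[] := truncn_itv th0.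
rewrite !ler_pdivlMr // !ltr_pdivrMr // /estep.
set i := Num.trunc (s / h) in lij *; set j := Num.trunc (t / h) in lij *.
move=> jt tj is' si.
have ej : j = (i + (j - i))%N by rewrite subnKC.
set m := (j - i)%N in ej.
have := @euler_slope h l e i m (ltW h0); rewrite -ej => /(_ _).
have H k : (i <= k < j)%N -> `|f (h * k%:R) (euler h k) - l| <= e.
  move=> /andP[ik kj]; rewrite -(estep_grid k h0); apply: fl.
    by rewrite mulr_ge0 // ltW.
  have ik' : i.+1%:R * h <= k.+1%:R * h by rewrite ler_pM2r // ler_nat.
  have kj' : k%:R * h <= j%:R * h by rewrite ler_pM2r // ler_nat ltnW.
  by move: ik'; rewrite -!natr1 in si * => ik'; apply/andP; split; lra.
move=> /(_ H).
have em : j%:R = i%:R + m%:R :> R by rewrite -natrD -ej.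
move: tj si jt is'; rewrite -!natr1 em.
set a := euler h j - euler h i; set p := h * m%:R => tj si jt is' ha.
have dp1 : p - (t - s) <= h by rewrite /p; lra.
have dp2 : - h <= p - (t - s) by rewrite /p; lra.
have -> : a - l * (t - s) = (a - l * p) + l * (p - (t - s)) by lra.
apply: le_trans (ler_normD _ _) _.
have H1 : e * p <= e * (t - s + h) by apply: ler_wpM2l => //; lra.
have H2 : `|l * (p - (t - s))| <= `|l| * h.
  by rewrite normrM; apply: ler_wpM2l => //; rewrite ler_norml dp2.
by lra.
Qed.

Lemma estep_slope h s t l e : 0 < h -> 0 <= s -> 0 <= t ->
  (forall r, 0 <= r -> `|r - t| <= `|s - t| + h -> `|f r (estep h r) - l| <= e) ->
  `|estep h s - estep h t - l * (s - t)| <= e * `|s - t| + (e + `|l|) * h.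
Proof.
move=> h0 s0 t0 fl; case: (leP s t) => st.
  rewrite (distrC s t) (ger0_norm (_ : 0 <= t - s)); last lra.
  rewrite -normrN.
  have -> : - (estep h s - estep h t - l * (s - t)) =
     estep h t - estep h s - l * (t - s) by lra.
  apply: estep_slope_le => // r r0 /andP[r1 r2]; apply: fl => //.
  by rewrite (distrC s t) (ger0_norm (_ : 0 <= t - s)) ?ler_norml; lra.
rewrite (ger0_norm (_ : 0 <= s - t)); last lra.
apply: estep_slope_le => //; first exact: ltW.
move=> r r0 /andP[r1 r2]; apply: fl => //.
by rewrite (ger0_norm (_ : 0 <= s - t)) ?ler_norml; lra.
Qed.

Hypothesis fK : forall t x, `|f t x| <= K.
Hypothesis fc : forall t x e, 0 < e -> exists2 d, 0 < d &
  forall s y, `|s - t| < d -> `|y - x| < d -> `|f s y - f t x| <= e.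

Lemma estep_lip h s t : 0 < h -> 0 <= s -> 0 <= t ->
  `|estep h s - estep h t| <= K * `|s - t| + K * h.
Proof.
move=> h0 s0 t0.
(* The crude bound: every slope is within [K] of 0. *)
have := @estep_slope h s t 0 K h0 s0 t0; rewrite mul0r subr0 normr0 addr0.
by apply=> r _ _; rewrite subr0.
Qed.

(* The pointwise limit along an ultrafilter replaces the Arzela-Ascoli
   extraction: the slope estimates are uniform in the mesh and pass to it. *)
Lemma bounded_ode_solution : exists2 F : R -> R, F 0 = 0 &
  forall t, 0 <= t -> hderiv F t (f t (F t)).
Proof.
have K0 : 0 <= K by apply: le_trans (normr_ge0 _) (fK 0 0).
have [U [UU ooU]] := ultraFilterLemma (eventually_filter : ProperFilter eventually).
pose h n : R := n.+1%:R^-1.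
have h0 n : 0 < h n by rewrite invr_gt0.
have hU e : 0 < e -> U [set n | h n < e].
  by move=> e0; apply: ooU; exact: near_infty_natSinv_lt (PosNum e0).
(* For fixed [t] the approximations with [h n < 1] stay in [[- B, B]]; compactness gives a cluster
   point, and along an ultrafilter a cluster point is a limit. Negative times get the dummy limit 0,
   so that [choice] yields a total function. *)
have limU t : exists p, 0 <= t -> forall e, 0 < e -> U [set n | `|estep (h n) t - p| < e].
  have [t0|t0] := leP 0 t; last by exists 0 => ?; lra.
  pose B := K * t + K.
  have /= := @segment_compact R (- B) B (fmap (fun n => estep (h n) t) U) _.
  case.
    apply: filterS (hU 1 ltr01) => n /= hn1; rewrite in_itv /= -ler_norml.
    have := estep_lip (h0 n) t0 (lexx 0); rewrite estep0 !subr0 (ger0_norm t0).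
    have : K * h n <= K * 1 by apply: ler_wpM2l => //; exact: ltW.
    by rewrite /B; lra.
  move=> p [_ clp]; exists p => _ e e0.
  have [//|nU] := in_ultra_setVsetC [set n | `|estep (h n) t - p| < e] UU.
  have [|q [/=]] := clp [set q | ~ (`|q - p| < e)] (ball p e) nU.
    exact: nbhsx_ballx.
  by rewrite -ball_normE /= distrC.
have [F hF] := choice limU; exists F => [|t t0 e e0].
  apply/eqP; rewrite -normr_le0; apply/ler_addgt0Pl => e e0; rewrite addr0.
  have [n /=] := filter_ex (hF 0 (lexx 0) e e0).
  by rewrite estep0 sub0r normrN => /ltW.
have [d d0 fd] := fc t (F t) e0.
have K1 : 0 < 2 * (K + 1) by lra.
(* This radius puts both [|s - t|] and [K * |s - t|] below [d / 2]; the other half of [d] absorbs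
   the mesh and the pointwise error. *)
exists (d / (2 * (K + 1))) => [|s s0]; first by rewrite divr_gt0.
rewrite ltr_pdivlMr // => st.
have st1 : `|s - t| <= `|s - t| * (K + 1) by rewrite ler_peMr //; lra.
set l := f t (F t) in fd *.
apply/ler_addgt0Pl => eta eta0.
have L0 : 0 < e + `|l| by rewrite ltr_wpDr.
(* The share [eta / 3] serves the errors at [s], at [t] and the mesh term [(e + |l|) * h n]; the
   bound [d / 8] keeps the approximations within [d] of [F t]. *)
pose a := Num.min (d / 8) (eta / 3).
have a0 : 0 < a by rewrite lt_min; apply/andP; split; lra.
have a1 : a <= d / 8 by rewrite ge_min lexx.
have a2 : a <= eta / 3 by rewrite ge_min lexx orbT.
have [n /= [[nt ns] [[n1 n2] n3]]] := filter_ex (filterI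
  (filterI (hF t t0 a a0) (hF s s0 a a0))
  (filterI (filterI (hU _ a0) (hU _ (divr_gt0 a0 K1))) (hU _ (divr_gt0 a0 L0)))).
move: n2 n3; rewrite !ltr_pdivlMr // => n2 n3.
have hn := h0 n.
have := @estep_slope (h n) s t l e hn s0 t0.
have slope r : 0 <= r -> `|r - t| <= `|s - t| + h n ->
    `|f r (estep (h n) r) - l| <= e.
  move=> r0 rt; apply: fd; first by lra.
  have -> : estep (h n) r - F t =
    (estep (h n) r - estep (h n) t) + (estep (h n) t - F t) by lra.
  apply: le_lt_trans (ler_normD _ _) _.
  have := estep_lip hn r0 t0; have := ler_wpM2l K0 rt; have := normr_ge0 (s - t); lra.
move=> /(_ slope) main.
have -> : F s - F t - l * (s - t) =
  (estep (h n) s - estep (h n) t - l * (s - t)) - (estep (h n) s - F s)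
  + (estep (h n) t - F t) by lra.
apply: le_trans (ler_normD _ _) _.
have := ler_normB (estep (h n) s - estep (h n) t - l * (s - t)) (estep (h n) s - F s).
by lra.
Qed.

End Euler.

(** * Existence by truncation *)

Section Existence.
Variable R : realType.
Implicit Types (g th w F : R -> R) (a b x y t e K M T : R).

Definition clamp a b x := Num.max a (Num.min x b).

Lemma clamp_id a b x : a <= x -> x <= b -> clamp a b x = x.
Proof. by move=> ax xb; rewrite /clamp (min_l xb) (max_r ax). Qed.

Lemma clamp_itv a b x : a <= b -> a <= clamp a b x <= b.
Proof. by move=> ab; rewrite /clamp le_max lexx ge_max ab ge_min lexx orbT. Qed.

Lemma clamp_lip a b x y : `|clamp a b y - clamp a b x| <= `|y - x|.
Proof.
have := ler_norm (y - x); have := ler_norm (x - y); rewrite (distrC x y).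
rewrite ler_norml /clamp.
by case: (leP x b) => ?; case: (leP y b) => ?;
   case: (leP a x) => ?; case: (leP a y) => ?; case: (leP a b) => ?; lra.
Qed.

Lemma clamp_continuous_near g a b x e : continuous g -> 0 < e ->
  exists2 d, 0 < d &
    forall y, `|y - x| < d -> `|g (clamp a b y) - g (clamp a b x)| <= e.
Proof.
move=> cg e0; have /cvgrPdist_le/(_ e e0)/nbhs_ballP[d d0 h] := cg (clamp a b x).
exists d => // y yx; rewrite distrC; apply: h; rewrite /ball /= distrC.
exact: le_lt_trans (clamp_lip _ _ _ _) yx.
Qed.

Lemma clamp_bounded g a b : a <= b -> continuous g ->
  exists K, forall x, `|g (clamp a b x)| <= K.
Proof.
move=> ab cg; have cgn : {within `[a, b], continuous (fun x : R => `|g x|)}.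
  apply: continuous_subspaceT => x; apply: continuous_comp; [exact: cg|].
  exact: norm_continuous.
have [c _ hc] := EVT_max ab cgn; exists `|g c| => x; apply: hc.
by rewrite in_itv /= clamp_itv.
Qed.

Variables th w : R -> R.
Hypothesis th_cont : continuous th.
Hypothesis th0 : th 0 = 0.
Hypothesis th_incr : increasing_pos th.
Hypothesis w_cont : continuous w.
Hypothesis w0 : w 0 <= 0.
Hypothesis w_unbounded : forall M, exists2 x : R, 0 <= x & M < w x.

(* A level X with w X > th T cannot be crossed before time T, so w may be
   frozen outside [0, X] and th outside [0, T]. *)
Lemma local_solution T : 0 <= T -> exists F, solves th w T F.
Proof.
move=> T0; have [X X0 wX] := w_unbounded (th T).
have thT t : 0 <= t <= T -> th t <= th T.
  move=> /andP[t0]; rewrite le_eqVlt => /orP[/eqP-> //|tT].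
  by apply/ltW/th_incr.
pose f t x := th (clamp 0 T t) - w (clamp 0 X x).
have [K1 b1] := clamp_bounded T0 th_cont.
have [K2 b2] := clamp_bounded X0 w_cont.
have [||F F0 hF] := @bounded_ode_solution R f (K1 + K2).
- by move=> t x; apply: le_trans (ler_normB _ _) (lerD _ _).
- move=> t x e e0; have e20 : 0 < e / 2 by lra.
  have [d d0 h] := clamp_continuous_near 0 T t th_cont e20.
  have [d' d'0 h'] := clamp_continuous_near 0 X x w_cont e20.
  exists (Num.min d d') => [|s y]; first by rewrite lt_min d0.
  rewrite !lt_min => /andP[/h h1 _] /andP[_ /h' h2].
  rewrite /f; set p := th _ in h1 *; set q := th _ in h1 *.
  set p' := w _ in h2 *; set q' := w _ in h2 *.
  have -> : p - p' - (q - q') = (p - q) - (p' - q') by lra.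
  by apply: le_trans (ler_normB _ _) _; lra.
(* At height [X] the slope of [F] is [th v - w X], which is negative because
   [th v <= th T < w X]. *)
have FX u : 0 <= u <= T -> 0 <= X - F u.
  apply: (@hderiv_barrier _ (fun v => X - F v) (fun v => 0 - f v (F v))) => //.
  - by rewrite F0 subr0.
  - move=> v /andP[v0 vT]; have hN := hderivN (hF v v0).
    apply: hderivD hN; rewrite (_ : (fun _ => _) = (fun v => 0 * v + X)).
      exact: hderiv_affine.
    by apply/funext => z; lra.
  - move=> v /andP[v0 vT] Fv; have {}Fv : F v = X by lra.
    rewrite /f Fv !clamp_id //; last by lra.
    by have := thT v ltac:(lra); lra.
have Fp u : 0 <= u <= T -> 0 <= F u.
  (* The level 0 is no strict barrier at time 0, where the slope [- w 0] may vanish. The level [- e]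
     can only be met at some [v > 0], where the slope is [th v - w 0 > 0]. *)
  move=> uT; apply/ler_addgt0Pr => e e0; move: u uT.
  apply: (@hderiv_barrier _ (fun v => F v + e) (fun v => f v (F v) + 0)) => //.
  - by rewrite F0; lra.
  - move=> v /andP[v0 vT]; apply: hderivD (hF v v0) _.
    rewrite (_ : (fun _ => _) = (fun v => 0 * v + e)).
      exact: hderiv_affine.
    by apply/funext => z; lra.
  - move=> v /andP[v0 vT] Fv; have {}Fv : F v = - e by lra.
    have vp : 0 < v.
      rewrite lt_neqAle v0 andbT; apply/eqP => E; move: Fv; rewrite -E F0; lra.
    rewrite /f Fv clamp_id ?(ltW vT) //.
    have -> : clamp 0 X (- e) = 0.
      by apply: max_l; rewrite ge_min; apply/orP; left; lra.
    rewrite addr0 subr_gt0; apply: le_lt_trans w0 _.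
    by rewrite -th0; apply: th_incr.
exists F; split=> // t /andP[t0 tT]; have tT' : 0 <= t <= T by rewrite t0 ltW.
split; first exact: Fp.
have := hF t t0; rewrite /f !clamp_id ?(ltW tT) //; first exact: Fp.
by have := FX t tT'; lra.
Qed.

Lemma global_solution_exists : exists F, gsolves th w F.
Proof.
have locF n : exists F, solves th w n.+1%:R F by apply: local_solution.
have [G hG] := choice locF.
pose F t := G (Num.trunc t) t.
have FG (n : nat) t : 0 <= t -> t < n.+1%:R -> F t = G n t.
  move=> t0 tn; apply: (solves_unique th_incr (hG _) (hG _)) => //.
  exact: truncnS_gt.
exists F; apply/gsolvesP; split.
  by rewrite (FG 0%N) ?ltr01 //; have [] := hG 0%N.
(* One unit beyond the truncation, so that the single solution [G n] covers a whole neighbourhood of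
   [t] of radius 1. *)
move=> t t0; pose n := (Num.trunc t).+1.
have tn : t + 1 < n.+1%:R by rewrite -natr1 ltrD2r truncnS_gt.
have [Gt hd] := (hG n).2 t ltac:(lra).
rewrite (FG n) //; last by lra.
split=> //; apply: hderiv_near (ltr01) t0 _ hd => s s0.
by rewrite ltr_norml => st; rewrite (FG n) //; lra.
Qed.

End Existence.

(** * Paths on the half-line as real functions *)

Section Bridge.
Variable R : realType.
Implicit Types (x y d e l : R) (s t : Rplus R) (phi : Rplus R -> Rplus R).
Implicit Types (f : Rplus R -> R).

Lemma mk_Rplus_subproof x : Num.max x 0 \in [set` `[(0 : R), +oo[].
Proof. by rewrite inE /= in_itv /= andbT le_max lexx orbT. Qed.

Definition mk_Rplus x : Rplus R := exist _ (Num.max x 0) (mk_Rplus_subproof x).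

Lemma val_Rplus_ge0 t : 0 <= \val t.
Proof. by have := valP t; rewrite inE /= in_itv /= andbT. Qed.

Lemma mk_RplusK x : 0 <= x -> \val (mk_Rplus x) = x.
Proof. by move=> x0; exact: max_l. Qed.

Lemma val_RplusK t : mk_Rplus (\val t) = t.
Proof. by apply: val_inj; rewrite mk_RplusK ?val_Rplus_ge0. Qed.

Lemma mk_Rplus0 : mk_Rplus 0 = zero_Rplus R.
Proof. by apply: val_inj => /=; exact: maxxx. Qed.

Lemma mk_Rplus_lip x y : `|\val (mk_Rplus y) - \val (mk_Rplus x)| <= `|y - x|.
Proof.
have := ler_norm (y - x); have := ler_norm (x - y).
rewrite (distrC x y) ler_norml /=.
by case: (leP x 0) => ?; case: (leP y 0) => ?; lra.
Qed.

Lemma nbhs_RplusP t (A : set (Rplus R)) : nbhs t A <->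
  exists2 d, 0 < d & forall s, `|\val s - \val t| < d -> A s.
Proof.
split=> [/nbhs_ballP[d d0 h]|[d d0 h]].
  by exists d => // s st; apply: h; rewrite distrC in st.
by apply/nbhs_ballP; exists d => // s st; apply: h; rewrite distrC.
Qed.

Lemma continuous_RplusP f : continuous f <-> forall t e, 0 < e ->
  exists2 d, 0 < d & forall s, `|\val s - \val t| < d -> `|f s - f t| < e.
Proof.
split=> [cf t e e0|h t].
  have /cvgrPdist_lt/(_ e e0)/nbhs_RplusP[d d0 h] := cf t.
  by exists d => // s /h /=; rewrite distrC.
apply/(@cvgrPdist_lt _ _ _ _ (nbhs_filter t)) => e e0; apply/nbhs_RplusP.
by have [d d0 hd] := h t e e0; exists d => // s /hd /=; rewrite distrC.
Qed.

Lemma continuous_Rplus_RplusP phi : continuous phi <->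
  continuous (fun t => \val (phi t) : R).
Proof.
split=> [cf|/continuous_RplusP h t].
  apply/continuous_RplusP => u e e0.
  have /nbhs_RplusP[d d0 hd] := cf u _ ((nbhs_RplusP (phi u)
    [set y | `|\val y - \val (phi u)| < e]).2 (ex_intro2 _ _ e e0 (fun _ => id))).
  by exists d.
move=> A /nbhs_RplusP[e e0 hA]; apply/nbhs_RplusP.
by have [d d0 hd] := h t e e0; exists d => // s /hd /hA.
Qed.

(** Constant extension to the negative reals, which preserves continuity. *)
Definition ext f x := f (mk_Rplus x).

Lemma ext_continuous f : continuous f -> continuous (ext f).
Proof.
move=> /continuous_RplusP cf x; apply/cvgrPdist_lt => e e0.
have [d d0 h] := cf (mk_Rplus x) e e0; apply/nbhs_ballP; exists d => // y xy.
have {}xy : `|x - y| < d := xy; rewrite distrC; apply: h.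
by apply: le_lt_trans (mk_Rplus_lip _ _) _; rewrite distrC.
Qed.

Definition lift phi x : R := \val (phi (mk_Rplus x)).

(** Multiplying by [|s - t|] removes the division, and the point [s = t], excluded from the limit,
    then satisfies the estimate trivially. *)
Lemma diff_quotient_cvgP phi t l :
  diff_quotient phi t s @[s --> t^'] --> l <-> hderiv (lift phi) (\val t) l.
Proof.
split.
  move=> /cvgrPdist_le h e e0; have /nbhs_RplusP[d d0 hd] := h e e0.
  exists d => // x x0 xt; have [->|nxt] := eqVneq x (\val t).
    by rewrite !subrr normr0 !mulr0 subrr normr0.
  have := hd (mk_Rplus x); rewrite mk_RplusK // => /(_ xt) /=.
  have nx : mk_Rplus x != t.
    by apply: contra_neq nxt => <-; rewrite mk_RplusK.
  move=> /(_ nx); rewrite /diff_quotient /lift val_RplusK mk_RplusK // => le.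
  have xt0 : x - \val t != 0 by rewrite subr_eq0.
  rewrite -[X in `|X - _|](divfK xt0) -mulrBl normrM distrC.
  by apply: ler_wpM2r.
move=> h; apply/cvgrPdist_le => e e0; apply/nbhs_RplusP.
have [d d0 hd] := h e e0; exists d => // s st /= nst.
have xt0 : \val s - \val t != 0.
  by rewrite subr_eq0; apply: contra_neq nst => /val_inj.
have := hd (\val s) (val_Rplus_ge0 s) st.
rewrite /lift !val_RplusK -[X in `|X - _|](divfK xt0) -mulrBl normrM distrC.
by rewrite ler_pM2r // normr_gt0.
Qed.

(** The half-line has no isolated point, as points to the right show even at 0; this makes [lim] in
    [path_derive] the actual derivative. *)
Lemma Rplus_dnbhs_proper t : ProperFilter t^'.
Proof.
apply: Build_ProperFilter_ex => A /nbhs_RplusP[d d0 h].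
have t0 := val_Rplus_ge0 t; have m0 : 0 <= \val t + d / 2 by lra.
exists (mk_Rplus (\val t + d / 2)); apply: h.
  rewrite mk_RplusK // addrAC subrr add0r gtr0_norm; lra.
apply/eqP => /(congr1 val); rewrite mk_RplusK //; lra.
Qed.

Lemma path_deriveE phi t l : hderiv (lift phi) (\val t) l ->
  path_derive phi t = l.
Proof.
move=> /diff_quotient_cvgP h; have := Rplus_dnbhs_proper t => ?.
exact/cvg_lim.
Qed.

Lemma path_deriveP phi t : cvg (diff_quotient phi t s @[s --> t^']) ->
  hderiv (lift phi) (\val t) (path_derive phi t).
Proof. by move=> h; apply/diff_quotient_cvgP. Qed.

Lemma lift_continuous phi (D : Rplus R -> R) :
  (forall t, hderiv (lift phi) (\val t) (D t)) -> continuous phi.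
Proof.
move=> h; apply/continuous_Rplus_RplusP/continuous_RplusP => t e e0.
have [d d0 hd] := hderiv_continuous (h t) e0; exists d => // s st.
by have := hd (\val s) (val_Rplus_ge0 s) st; rewrite /lift !val_RplusK.
Qed.

Lemma C10_hderiv phi : C10_path phi ->
  lift phi 0 = 0 /\ forall x, 0 <= x ->
    hderiv (lift phi) x (path_derive phi (mk_Rplus x)).
Proof.
move=> [phi0 cv _]; split; first by rewrite /lift mk_Rplus0 phi0.
by move=> x x0; have := path_deriveP (cv (mk_Rplus x)); rewrite mk_RplusK.
Qed.

(** Continuity of the derivative comes for free: the equation makes it [theta - w o phi], and [phi]
    is continuous because it is differentiable. *)
Lemma global_solutionP (theta w : Rplus R -> R) g phi :
  continuous theta -> continuous w -> (forall s t, g (s, t) = theta s - w t) ->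
  global_solution g phi <-> gsolves (ext theta) (ext w) (lift phi).
Proof.
move=> cth cw gE; split.
  move=> [/C10_hderiv[phi0 h] pd]; apply/gsolvesP; split=> // x x0; split.
    exact: val_Rplus_ge0.
  by have := h x x0; rewrite pd gE /ext /lift val_RplusK.
move=> /gsolvesP[phi0 h].
have hd t : hderiv (lift phi) (\val t) (theta t - w (phi t)).
  have := (h (\val t) (val_Rplus_ge0 t)).2.
  by rewrite /ext /lift !val_RplusK.
have pd t : path_derive phi t = theta t - w (phi t) by exact: path_deriveE.
split; last by move=> t; rewrite pd gE.
split.
- by apply: val_inj; move: phi0; rewrite /lift mk_Rplus0.
- by move=> t; apply/cvg_ex; eexists; apply/diff_quotient_cvgP/hd.
- rewrite (_ : path_derive phi = fun t => theta t - w (phi t)); last exact/funext.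
  have cphi := lift_continuous hd; move=> t.
  have cwphi := continuous_comp (cphi t) (cw (phi t)).
  exact: (cvgB (cth t) cwphi).
Qed.

Lemma lift_mk_Rplus (F : R -> R) x : 0 <= x -> 0 <= F x ->
  lift (fun t => mk_Rplus (F (\val t))) x = F x.
Proof. by move=> x0 Fx0; rewrite /lift !mk_RplusK. Qed.

Lemma lift_inj phi psi : (forall x, 0 <= x -> lift phi x = lift psi x) -> phi = psi.
Proof.
move=> h; apply/funext => t; apply: val_inj.
by have := h (\val t) (val_Rplus_ge0 t); rewrite /lift val_RplusK.
Qed.

(** If [phi y <= phi x] with [x < y], the path, starting from 0, already takes the value [phi y] on
    [[0, x]], against injectivity. *)
Lemma lift_increasing phi : C10_path phi -> injective phi ->
  forall x y, 0 <= x -> x < y -> lift phi x < lift phi y.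
Proof.
move=> /C10_hderiv[phi0 h] phi_inj x y x0 xy; rewrite ltNge; apply/negP => yx.
have y0 : 0 <= y by lra.
have [||c] := @IVT R (fun z => lift phi (Num.max z 0)) 0 x (lift phi y) x0.
- exact/continuous_subspaceT/(pos_continuous h).
- rewrite maxxx phi0 (max_l x0) ge_min (val_Rplus_ge0 _) /=.
  by rewrite le_max yx orbT.
- rewrite in_itv /= => /andP[c0 cx]; rewrite (max_l c0) => /val_inj/phi_inj.
  by move=> /(congr1 val); rewrite !mk_RplusK //; lra.
Qed.

(** Monotonicity suffices: [psi z] is trapped between [a - e] and [a + e] once [z] lies between
    their images. *)
Lemma Phi_inverse_continuous phi psi : C10_path phi -> cancel phi psi ->
  cancel psi phi -> continuous psi.
Proof.
move=> C1 phiK psiK; have incr := lift_increasing C1 (can_inj phiK).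
apply/continuous_Rplus_RplusP/continuous_RplusP => y e e0.
pose a := \val (psi y); have a0 : 0 <= a := val_Rplus_ge0 _.
have Fpsi z : lift phi (\val (psi z)) = \val z by rewrite /lift val_RplusK psiK.
have lt_psi z b : 0 <= b -> \val z < lift phi b -> \val (psi z) < b.
  move=> b0; rewrite -(Fpsi z) ltNge => zb; rewrite ltNge; apply: contra zb.
  by rewrite le_eqVlt => /orP[/eqP-> //|/(incr _ _ b0)/ltW].
have gt_psi z b : lift phi b < \val z -> b < \val (psi z).
  rewrite -(Fpsi z) ltNge => zb; rewrite ltNge; apply: contra zb.
  by rewrite le_eqVlt => /orP[/eqP-> //|/(incr _ _ (val_Rplus_ge0 _))/ltW].
have u0 : 0 < lift phi (a + e) - \val y by rewrite subr_gt0 -(Fpsi y) incr // ltrDl.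
have [ae|ae] := leP 0 (a - e).
  have l0 : 0 < \val y - lift phi (a - e) by rewrite subr_gt0 -(Fpsi y) incr //; rewrite /a; lra.
  exists (Num.min (lift phi (a + e) - \val y) (\val y - lift phi (a - e))).
    by rewrite lt_min u0.
  move=> z; rewrite lt_min !ltr_norml => /andP[/andP[_ z1] /andP[z2 _]].
  have := lt_psi z (a + e) ltac:(lra) ltac:(lra).
  by have := gt_psi z (a - e) ltac:(lra); rewrite -/a; lra.
(* Here [a - e < 0], so the lower bound is just [psi z >= 0]. *)
exists (lift phi (a + e) - \val y) => // z; rewrite !ltr_norml => /andP[_ z1].
have := lt_psi z (a + e) ltac:(lra) ltac:(lra).
by have := val_Rplus_ge0 (psi z); rewrite -/a; lra.
Qed.

(** The path starts at 0 and never goes below it. This yields [w 0 <= 0] for the reconstructed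
    potential. *)
Lemma path_derive0_ge0 phi : C10_path phi -> 0 <= path_derive phi (zero_Rplus R).
Proof.
move=> /C10_hderiv[phi0 h]; rewrite -mk_Rplus0 leNgt; apply/negP.
set l := path_derive _ _ => l0; have [d d0 hd] := h 0 (lexx 0) (- l / 2) ltac:(lra).
have d20 : 0 < d / 2 by lra.
have := hd (d / 2) (ltW d20); rewrite phi0 !subr0 (gtr0_norm d20) => /(_ ltac:(lra)).
rewrite -/l ler_norml => /andP[_]; have : 0 <= lift phi (d / 2) := val_Rplus_ge0 _.
have : l * (d / 2) < 0 by rewrite pmulr_llt0.
by lra.
Qed.

End Bridge.

(** * The correspondence between potentials and paths *)

Section Representation.
Variables (R : realType) (theta : Rplus R -> R).
Hypothesis theta_C0 : C0_path theta.
Hypothesis theta_incr : strictly_increasing theta.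
Hypothesis theta_infty : theta t @[t --> @infty_Rplus R] --> +oo.
Implicit Types (w : Rplus R -> R) (phi : Rplus R -> Rplus R).

Lemma theta_large (K : R) :
  exists2 a : R, 0 <= a & forall t : Rplus R, a <= \val t -> K <= theta t.
Proof.
have [a _ ha] := theta_infty (nbhs_pinfty_ge (num_real K)).
by exists (Num.max a 0) => [|t]; rewrite ?le_max ?lexx ?orbT // ge_max => /andP[/ha].
Qed.

Lemma ext_theta_incr : increasing_pos (ext theta).
Proof.
by move=> x y x0 xy; apply: theta_incr; rewrite !mk_RplusK //; lra.
Qed.

Lemma ext_theta_large (K : R) :
  exists2 a : R, 0 <= a & forall x, a <= x -> K <= ext theta x.
Proof.
have [a a0 ha] := theta_large K; exists a => // x ax; apply: ha.
by rewrite mk_RplusK //; lra.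
Qed.

Lemma ereal_sup_range_unbounded (T : Type) (f : T -> R) :
  ereal_sup (range (fun x => (f x)%:E)) = +oo%E <-> forall M, exists x, M < f x.
Proof.
split=> [fy M|h].
  have : (M%:E < ereal_sup (range (fun x => (f x)%:E)))%E by rewrite fy ltry.
  by move=> /ereal_sup_gt[_ [x _ <-]]; rewrite lte_fin; exists x.
apply/eqP; rewrite eq_le leey /=; apply: contrapT => /negP; rewrite -ltNge.
case: ereal_sup (ereal_sup_ubound (S := range (fun x => (f x)%:E))) => [r|//|] ub _.
  have [x rx] := h r; have := ub (f x)%:E; rewrite lee_fin leNgt rx => hx.
  by have := hx (ex_intro2 _ _ x I erefl).
have [x _] := h 0; have := ub (f x)%:E; rewrite leNgt ltNyr => hx.
by have := hx (ex_intro2 _ _ x I erefl).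
Qed.

(** * Well-posedness for a fixed potential *)

Section Potential.
Variable w : Rplus R -> R.
Hypothesis w_cont : continuous w.
Hypothesis w0 : w (zero_Rplus R) <= 0.
Hypothesis w_unbounded : forall M, exists x, M < w x.

Lemma ext_w_bounded (B : R) : exists K, forall x, 0 <= x <= B -> ext w x <= K.
Proof.
have [B0|B0] := leP 0 B; last by exists 0 => x; lra.
have [K hK] := clamp_bounded B0 (ext_continuous w_cont).
exists K => x /andP[x0 xB]; apply: le_trans (ler_norm _) _.
by have := hK x; rewrite clamp_id.
Qed.

Lemma potential_solution_exists : exists phi, gsolves (ext theta) (ext w) (lift phi).
Proof.
have [||||||F sF] := @global_solution_exists R (ext theta) (ext w).
- exact/ext_continuous/theta_C0.1.
- by rewrite /ext mk_Rplus0 theta_C0.2.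
- exact: ext_theta_incr.
- exact: ext_continuous.
- by rewrite /ext mk_Rplus0.
- move=> M; have [x Mx] := w_unbounded M; exists (\val x).
    exact: val_Rplus_ge0.
  by rewrite /ext val_RplusK.
have [F0 hF] := (gsolvesP _ _ _).1 sF.
exists (fun t => mk_Rplus (F (\val t))); apply/gsolvesP; split.
  by rewrite lift_mk_Rplus // F0.
move=> x x0; have [Fx hd] := hF x x0; rewrite lift_mk_Rplus //; split=> //.
apply: hderiv_near ltr01 x0 _ hd => y y0 _.
by rewrite lift_mk_Rplus //; exact: (hF y y0).1.
Qed.

Lemma potential_solution_unique phi psi :
  gsolves (ext theta) (ext w) (lift phi) ->
  gsolves (ext theta) (ext w) (lift psi) -> phi = psi.
Proof.
move=> s1 s2; apply: lift_inj => x x0.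
by apply: (solves_unique ext_theta_incr (s1 (x + 1)) (s2 (x + 1))) => //; lra.
Qed.

Lemma potential_solution_bijective phi :
  gsolves (ext theta) (ext w) (lift phi) -> bijective phi.
Proof.
move=> sphi.
have surj u : exists t, phi t = u.
  have [x x0 hx] := gsolves_surjective ext_w_bounded ext_theta_large sphi (val_Rplus_ge0 u).
  by exists (mk_Rplus x); exact: val_inj.
have [psi hpsi] := choice surj; exists psi => // t.
have lt_phi s u : \val s < \val u -> \val (phi s) < \val (phi u).
  move=> su; have := solves_increasing ext_theta_incr (sphi (\val u + 1))
    (val_Rplus_ge0 s) su ltac:(lra).
  by rewrite /lift !val_RplusK.
(* The chosen right inverse is also a left inverse, since strict monotonicity excludes both strict
   inequalities. *)
have E := congr1 val (hpsi (phi t)); apply: val_inj.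
by have [/lt_phi|/lt_phi|//] := ltgtP (\val (psi (phi t))) (\val t); rewrite E ltxx.
Qed.

End Potential.

(** * The solution map and its inverse *)

Lemma GTheta_potential g : GTheta theta g -> exists w,
  [/\ continuous w, w (zero_Rplus R) <= 0, forall M, exists x, M < w x
    & forall t x, g (t, x) = theta t - w x].
Proof.
move=> [_ [w [cw w0 wy gE]]]; exists w; split=> //.
exact/ereal_sup_range_unbounded.
Qed.

Lemma GTheta_unique_solution g : GTheta theta g -> exists! phi, global_solution g phi.
Proof.
move=> /GTheta_potential[w [cw w0 wy gE]].
have solP phi := global_solutionP phi theta_C0.1 cw gE.
have [phi sphi] := potential_solution_exists cw w0 wy.
exists phi; split; first exact/solP.
by move=> psi /solP; exact: potential_solution_unique.
Qed.

Lemma solutionP g : GTheta theta g -> global_solution g (solution g).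
Proof.
move=> /GTheta_unique_solution[phi [sphi _]]; rewrite /solution.
have := @xgetPex _ (@id (Rplus R)) [set phi | global_solution g phi].
by apply; exists phi.
Qed.

(** Along the solution, [theta - phi'] is [w o phi]; as [phi] is onto, it is unbounded above like
    [w]. *)
Lemma solution_PhiTheta g : GTheta theta g -> PhiTheta theta (solution g).
Proof.
move=> gG; have sg := solutionP gG; have [w [cw w0 wy gE]] := GTheta_potential gG.
have /(potential_solution_bijective cw)[psi phiK psiK] :=
  (global_solutionP (solution g) theta_C0.1 cw gE).1 sg.
split; first by split; [exact: sg.1 | exists psi].
apply/ereal_sup_range_unbounded => M; have [x Mx] := wy M; exists (psi x).
by rewrite sg.2 psiK gE opprB addrC subrK.
Qed.

(** Since [phi] is onto, the equation at time [psi x] determines [w x], and hence [g]. *)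
Lemma solution_inj : set_inj (GTheta theta) (@solution R).
Proof.
move=> g1 g2 /[!inE] G1 G2 E.
have [_ [[phiC [psi phiK psiK]] _]] := (I, solution_PhiTheta G1).
have [w1 [_ _ _ E1]] := GTheta_potential G1.
have [w2 [_ _ _ E2]] := GTheta_potential G2.
have [_ d1] := solutionP G1; have [_ d2] := solutionP G2.
have Ew x : w1 x = w2 x.
  have := d1 (psi x); have := d2 (psi x); rewrite -E psiK E1 E2 => ->.
  by move=> /subrI.
by apply/funext => -[t x]; rewrite E1 E2 Ew.
Qed.

(** The infimum condition of [GSet] comes from the unboundedness of [w], the supremum condition from
    that of [theta]. *)
Lemma potential_GTheta w : continuous w -> w (zero_Rplus R) <= 0 ->
  (forall M, exists x, M < w x) ->
  GTheta theta (fun tx => theta tx.1 - w tx.2).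
Proof.
move=> cw w0 wy; split; last first.
  by exists w; split=> //; exact/ereal_sup_range_unbounded.
split.
- move=> tx; apply: cvgB.
    apply: (@continuous_comp _ _ _ fst theta); first exact: cvg_fst.
    exact: theta_C0.1.
  by apply: (@continuous_comp _ _ _ snd w); [exact: cvg_snd | exact: cw].
- by rewrite /= theta_C0.2 sub0r oppr_ge0.
- by move=> x s t st /=; rewrite ltrD2r theta_incr.
- move=> t; have [x tx] := wy (theta t).
  apply: (@le_lt_trans _ _ (theta t - w x)%:E); last by rewrite lte_fin subr_lt0.
  by apply: ereal_inf_lbound; exists x.
- move=> x; have [a a0 ha] := theta_large (w x + 1).
  apply: (@lt_le_trans _ _ (theta (mk_Rplus a) - w x)%:E); last first.
    by apply: ereal_sup_ubound; exists (mk_Rplus a).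
  by rewrite lte_fin; have := ha (mk_Rplus a); rewrite mk_RplusK // lexx => /(_ isT); lra.
Qed.

Lemma solution_surj : set_surj (GTheta theta) (PhiTheta theta) (@solution R).
Proof.
move=> phi [[C1 [psi phiK psiK]] /ereal_sup_range_unbounded phiy].
pose w x := theta (psi x) - path_derive phi (psi x).
have cpsi := Phi_inverse_continuous C1 phiK psiK.
have [phi0 _ cpd] := C1.
have gG : GTheta theta (fun tx => theta tx.1 - w tx.2).
  apply: potential_GTheta.
  - move=> x; have ctheta := continuous_comp (cpsi x) (theta_C0.1 (psi x)).
    exact: (cvgB ctheta (continuous_comp (cpsi x) (cpd (psi x)))).
  - rewrite /w -{1 2}phi0 phiK theta_C0.2 sub0r oppr_le0.
    exact: path_derive0_ge0.
  - by move=> M; have [t Mt] := phiy M; exists (phi t); rewrite /w phiK.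
exists (fun tx => theta tx.1 - w tx.2) => //.
have [psi' [_ uniq]] := GTheta_unique_solution gG.
(* By the choice of [w], [phi] solves the equation; uniqueness identifies it with the selected
   [solution]. *)
rewrite -(uniq _ (solutionP gG)); apply: uniq; split=> // t.
by rewrite /w /= phiK opprB addrC subrK.
Qed.

End Representation.

Theorem mainTheorem7 (R : realType) (theta : Rplus R -> R)
  (theta_C0 : C0_path theta)
  (theta_incr : strictly_increasing theta)
  (theta_infty : theta t @[t --> @infty_Rplus R] --> +oo) :
  (forall g, GTheta theta g -> exists! phi, global_solution g phi) /\
  set_bij (GTheta theta) (PhiTheta theta) (@solution R).
Proof.
split; first exact: GTheta_unique_solution.
split; [exact: solution_PhiTheta | exact: solution_inj | exact: solution_surj].
Qed.
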